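(* Let $l\ge1$ be an integer and $(a_0,\dots,a_{l-1})\in\mathbb{R}^l$, and set $a_l:=1$. Consider the planar system given in polar coordinates $(\rho,\varphi)$ by $$\dot\rho=-\rho\left(\rho^{-2l}+\sum_{j=0}^{l-1}a_j\rho^{-2j}\right),\qquad\dot\varphi=1,$$ and let $\Gamma$ be a part of a trajectory of this system near infinity (an unbounded spiral piece lying at positive distance from the origin). (a) If $a_0\neq0$, then $\Gamma$ is of exponential type, namely comparable with the spiral $\rho=e^{-a_0\varphi}$, and $\dim_B\Gamma=1$. (b) If $1\le k\le l$ is fixed and $a_0=\dots=a_{k-1}=0$, $a_k\neq0$, then $\Gamma$ is comparable with the spiral $\rho=|\varphi|^{1/(2k)}$, and $$\dim_B\Gamma=\frac{4k}{2k+1}.$$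
   Context: This system is obtained from the Hopf–Takens normal form $\dot r=r(r^{2l}+\sum_{j=0}^{l-1}a_jr^{2j})$, $\dot\varphi=1$ by $\rho=1/r$. A spiral $\rho=F(\varphi)$ is comparable with $\rho=G(\varphi)$ if there are constants $c_1,c_2>0$ with $c_1G(\varphi)\le F(\varphi)\le c_2G(\varphi)$ for all $\varphi$ in the end of the range of angles along which the spiral tends to infinity. For a nonempty bounded $B\subset\mathbb{R}^2$, with $B_\varepsilon$ its $\varepsilon$-neighbourhood and $|B_\varepsilon|$ its area, $\overline{\dim}_BB=\inf\{s:\limsup_{\varepsilon\to0}|B_\varepsilon|/\varepsilon^{2-s}=0\}$, $\underline{\dim}_BB$ the same with $\liminf$, $\dim_BB$ their common value; for an unbounded $A\subset\mathbb{R}^2$ with $0\notin\overline A$, $\dim_BA:=\dim_B\Phi(A)$, $\Phi(x)=x/|x|^2$. *)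

(* Defs.v *)
From HB Require Import structures.
From mathcomp Require Import all_boot all_order all_algebra.
From mathcomp Require Import all_classical all_reals all_analysis.
Set Implicit Arguments. Unset Strict Implicit. Unset Printing Implicit Defensive.
Import Order.TTheory GRing.Theory Num.Theory.
Import numFieldNormedType.Exports.
Local Open Scope classical_set_scope.
Local Open Scope ring_scope.

Definition edist {R : realType} (x y : R * R) : R :=
  Num.sqrt ((x.1 - y.1) ^+ 2 + (x.2 - y.2) ^+ 2).

Definition eps_nbhd {R : realType} (B : set (R * R)) (e : R) : set (R * R) :=
  [set x | exists2 b, B b & edist x b < e].

Definition area {R : realType} (A : set (R * R)) : \bar R :=
  ((@lebesgue_measure R) \x (@lebesgue_measure R))%E A.

Definition limsup0 {R : realType} (g : R -> \bar R) : \bar R :=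
  ereal_inf [set ereal_sup [set g e | e in [set e : R | 0 < e < d]]
            | d in [set d : R | 0 < d]].
Definition liminf0 {R : realType} (g : R -> \bar R) : \bar R :=
  ereal_sup [set ereal_inf [set g e | e in [set e : R | 0 < e < d]]
            | d in [set d : R | 0 < d]].

Definition box_ratio {R : realType} (B : set (R * R)) (s e : R) : \bar R :=
  (area (eps_nbhd B e) * ((e `^ (2 - s))^-1)%:E)%E.

Definition upper_box_dim {R : realType} (B : set (R * R)) : \bar R :=
  ereal_inf [set s%:E | s in [set s : R | limsup0 (box_ratio B s) = 0%E]].
Definition lower_box_dim {R : realType} (B : set (R * R)) : \bar R :=
  ereal_inf [set s%:E | s in [set s : R | liminf0 (box_ratio B s) = 0%E]].

Definition has_box_dim {R : realType} (B : set (R * R)) (d : R) : Prop :=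
  B !=set0 /\ (exists M : R, forall x, B x -> edist x (0, 0) <= M) /\
  upper_box_dim B = d%:E /\ lower_box_dim B = d%:E.

Definition inversion {R : realType} (x : R * R) : R * R :=
  (x.1 / (x.1 ^+ 2 + x.2 ^+ 2), x.2 / (x.1 ^+ 2 + x.2 ^+ 2)).

Definition has_box_dim_unb {R : realType} (A : set (R * R)) (d : R) : Prop :=
  ~ closure A (0, 0) /\ has_box_dim (inversion @` A) d.

Definition acoef {R : realType} (l : nat) (a : nat -> R) (j : nat) : R :=
  if j == l then 1 else a j.

Definition rho_rhs {R : realType} (l : nat) (a : nat -> R) (rho : R) : R :=
  - rho * (rho ^- (2 * l) + \sum_(j < l) a j * rho ^- (2 * j)).

Definition angle_range {R : realType} (up : bool) (phi0 : R) : set R :=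
  if up then [set phi | phi0 <= phi] else [set phi | phi <= phi0].

Definition spiral {R : realType} (up : bool) (phi0 : R) (F : R -> R)
  : set (R * R) :=
  [set (F phi * cos phi, F phi * sin phi) | phi in angle_range up phi0].

(* Gamma = {rho = F(phi)} is a part of a trajectory of the system near
   infinity: since phi' = 1 the angle phi is a time parameter, so F solves
   dF/dphi = rho_rhs(F); F > 0, bounded away from 0, and F -> +oo at the
   end of the range of angles. *)
Definition traj_near_infinity {R : realType} (l : nat) (a : nat -> R)
  (up : bool) (phi0 : R) (F : R -> R) : Prop :=
  (forall phi, angle_range up phi0 phi -> is_derive phi 1 F (rho_rhs l a (F phi)))
  /\ (exists m : R, 0 < m /\ forall phi, angle_range up phi0 phi -> m <= F phi)
  /\ (if up then F x @[x --> +oo] --> +oo else F x @[x --> -oo] --> +oo).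

Definition spiral_comparable {R : realType} (up : bool) (phi0 : R) (F G : R -> R)
  : Prop :=
  exists c1 c2 : R, 0 < c1 /\ 0 < c2 /\
    exists phi1 : R, forall phi, angle_range up phi0 phi ->
      (if up then phi1 <= phi else phi <= phi1) ->
      c1 * G phi <= F phi <= c2 * G phi.

(* Main.v *)
(* With f = 1/F the trajectory is inverted to the spiral r = f(t), where
   f' = - f^(2k+1) q and q tends to a constant b, which is positive because f
   tends to 0.  Hence -ln f (if k = 0) or f^(-2k) (if k > 0) has derivative q
   or 2 k q, bounded between positive constants for large t: this gives the
   comparison with the model spirals.
   If k = 0 the inverted spiral has finite length and positive diameter, so its
   e-neighbourhood has area of order e.  If k > 0 put alpha = 1/(2k), so that
   f ~ t^(-alpha); consecutive turns are closer than e once t exceeds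
   T ~ e^(-1/(1+alpha)).  The rest of the spiral then fills a disc of radius
   T^(-alpha), while the part before T has length of order T^(1-alpha); both
   contribute an area of order e^(2 alpha/(1+alpha)). *)

Require Import Defs.
From HB Require Import structures.
From mathcomp Require Import all_boot all_order all_algebra.
From mathcomp Require Import all_classical all_reals all_analysis.
From mathcomp Require Import measurable_realfun ring lra.
Import Order.TTheory GRing.Theory Num.Theory.
Import numFieldNormedType.Exports.
Local Open Scope classical_set_scope.
Local Open Scope ring_scope.

(* MathComp-Analysis has its own [edist], imported after that of Defs. *)
Local Notation edist := Defs.edist.

(** * Area of planar sets *)

(** Every point of an open set lies in a square with rational centre and radius contained in that
    set, so the set is a countable union of measurable boxes. *)
Lemma open_measurable2 (R : realType) (A : set (R * R)) :
  open A -> measurable (A : set (measurableTypeR R * measurableTypeR R)).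
Proof.
move=> oA.
pose box (q : rat * rat * rat) : set (R * R) :=
  ball (ratr q.1.1 : R) (ratr q.2) `*` ball (ratr q.1.2 : R) (ratr q.2).
pose F q := if `[< box q `<=` A >] then box q else set0.
have -> : A = \bigcup_q F q.
  apply/seteqP; split => [x Ax|x [q _]]; last first.
    by rewrite /F; case: asboolP => // h /h.
  have /nbhs_ballP[e /= e0 sA] := open_nbhs_nbhs (conj oA Ax).
  (* A square of radius [r] containing [x] stays within [2 * r < e] of [x]. *)
  have [r] : exists r : rat, ratr r \in `]0, (e / 2)[.
    by apply: rat_in_itvoo; rewrite divr_gt0.
  rewrite in_itv /= => /andP[r0 re].
  have cen (z : R) : exists q : rat, ball (ratr q : R) (ratr r) z.
    have [q] : exists q : rat, ratr q \in `]z, (z + ratr r)[.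
      by apply: rat_in_itvoo; rewrite ltrDl.
    rewrite in_itv /= => /andP[zq qz]; exists q.
    rewrite /ball /= ger0_norm; lra.
  have [q1 b1] := cen x.1; have [q2 b2] := cen x.2.
  exists (q1, q2, r) => //; rewrite /F asboolT; first by split.
  move=> y [/= h1 h2]; apply: sA; split => /=.
    have := ball_triangle (ball_sym b1) h1; apply: le_ball; lra.
  have := ball_triangle (ball_sym b2) h2; apply: le_ball; lra.
apply: countable_bigcupT_measurable => [|q]; first exact: countableP.
rewrite /F; case: asboolP => _; last exact: measurable0.
by apply: measurableX; rewrite ball_itv; exact: measurable_itv.
Qed.

Lemma edist_lt (R : realType) (x y : R * R) (e : R) : 0 < e ->
  (edist x y < e) = ((x.1 - y.1) ^+ 2 + (x.2 - y.2) ^+ 2 < e ^+ 2).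
Proof.
move=> e0; rewrite /edist -[X in _ < X](gtr0_norm e0) -sqrtr_sqr ltr_sqrt //.
by rewrite exprn_gt0.
Qed.

Lemma eps_nbhd_open (R : realType) (B : set (R * R)) (e : R) : 0 < e ->
  open (eps_nbhd B e).
Proof.
move=> e0; have -> : eps_nbhd B e = \bigcup_(b in B)
    ((fun x : R * R => (x.1 - b.1) ^+ 2 + (x.2 - b.2) ^+ 2) @^-1`
      [set z : R | z < e ^+ 2]).
  apply/seteqP; split => x [b Bb xb]; exists b => //.
    by rewrite /= -edist_lt.
  by rewrite edist_lt.
apply: bigcup_open => b Bb; apply: open_comp; last exact: open_lt.
move=> x _.
have c1 : (y.1 - b.1) @[y --> x] --> x.1 - b.1.
  by apply: cvgB; [exact: cvg_fst|exact: cvg_cst].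
have c2 : (y.2 - b.2) @[y --> x] --> x.2 - b.2.
  by apply: cvgB; [exact: cvg_snd|exact: cvg_cst].
exact: (cvgD (cvgM c1 c1) (cvgM c2 c2)).
Qed.

Lemma eps_nbhd_measurable (R : realType) (B : set (R * R)) (e : R) : 0 < e ->
  measurable (eps_nbhd B e : set (measurableTypeR R * measurableTypeR R)).
Proof. by move=> e0; apply: open_measurable2; exact: eps_nbhd_open. Qed.

Definition square {R : realType} (p : R * R) (h : R) : set (R * R) :=
  [set` `[p.1 - h, p.1 + h]] `*` [set` `[p.2 - h, p.2 + h]].

Lemma square_measurable (R : realType) (p : R * R) (h : R) :
  measurable (square p h : set (measurableTypeR R * measurableTypeR R)).
Proof. by apply: measurableX; exact: measurable_itv. Qed.

Lemma area_square (R : realType) (p : R * R) (h : R) : 0 < h ->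
  area (square p h) = (4 * h ^+ 2)%:E.
Proof.
move=> h0; rewrite /area product_measure1E; [|exact: measurable_itv..].
have side (c : R) :
    lebesgue_measure ([set` `[c - h, c + h]] : set R) = (2 * h)%:E.
  rewrite lebesgue_measure_itv /= lte_fin ifT; last by lra.
  by rewrite -EFinB; congr EFin; ring.
have -> : (4 * h ^+ 2)%:E = ((2 * h)%:E * (2 * h)%:E)%E.
  by rewrite -EFinM; congr EFin; ring.
by congr (_ * _)%E; exact: side.
Qed.

Lemma area_le (R : realType) (A B : set (R * R)) :
  measurable (A : set (measurableTypeR R * measurableTypeR R)) ->
  measurable (B : set (measurableTypeR R * measurableTypeR R)) ->
  A `<=` B -> (area A <= area B)%E.
Proof. by move=> mA mB AB; apply: le_measure; rewrite ?inE. Qed.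

(** The sizes depend on the index because a spiral of power type is covered by many small squares
    and one large square around the origin. *)
Lemma area_le_squares (R : realType) (A : set (R * R)) (h : nat -> R)
    (n : nat) (p : nat -> R * R) :
  (forall i, 0 < h i) ->
  measurable (A : set (measurableTypeR R * measurableTypeR R)) ->
  A `<=` \big[setU/set0]_(i < n) square (p i) (h i) ->
  (area A <= (\sum_(i < n) 4 * h i ^+ 2)%:E)%E.
Proof.
move=> h0 mA sA.
pose F i : set (measurableTypeR R * measurableTypeR R) := square (p i) (h i).
apply: (@le_trans _ _ (\sum_(i < n) area (F i))%E).
  apply: (@content_subadditive _ _ _
    ((@lebesgue_measure R) \x (@lebesgue_measure R))%E A F n) => // i _.
  exact: square_measurable.
by rewrite -sumEFin; apply: lee_sum => i _; rewrite /F area_square.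
Qed.

(** Fubini: each vertical section over [[lo, hi]] contains an interval of length [2 * w]. The
    centres [y] enter only through the sections, so they may come from a choice. *)
Lemma area_ge_projection (R : realType) (A : set (R * R)) (lo hi w : R)
    (y : R -> R) :
  measurable (A : set (measurableTypeR R * measurableTypeR R)) ->
  lo < hi -> 0 < w ->
  (forall x z, lo <= x <= hi -> `|z - y x| < w -> A (x, z)) ->
  (((hi - lo) * (2 * w))%:E <= area A)%E.
Proof.
move=> mA lohi w0 hA; rewrite /area /= /product_measure1 /=.
pose mu := @lebesgue_measure R.
pose g : measurableTypeR R -> \bar R := mu \o xsection A.
have mS : measurable_fun setT g.
  exact: (measurable_fun_xsection (@lebesgue_measure R) mA).
have -> : ((hi - lo) * (2 * w))%:E = (\int[mu]_(x in [set` `[lo, hi]]) cst (2 * w)%:E x)%E.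
  apply/esym; apply: etrans (integral_cst mu (measurable_itv `[lo, hi]) _) _.
  rewrite [(hi - lo) * _]mulrC [RHS]EFinM; congr (_ * _)%E.
  by apply: etrans (lebesgue_measure_itv _) _; rewrite /= lte_fin lohi.
apply: (@le_trans _ _ (\int[mu]_(x in [set` `[lo, hi]]) g x)%E).
  apply: ge0_le_integral => //.
  - by move=> x _; rewrite lee_fin; lra.
  - exact: measurable_funS mS.
  move=> x /=; rewrite in_itv /= => lxh.
  have -> : (2 * w)%:E = mu [set` `]y x - w, y x + w[].
    apply/esym; apply: etrans (lebesgue_measure_itv _) _.
    rewrite /= lte_fin ifT; last by lra.
    by rewrite -EFinB; congr EFin; ring.
  apply: le_measure; rewrite ?inE //.
  - exact: measurable_xsection.
  move=> z /=; rewrite in_itv /= => zI; rewrite /xsection /= inE.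
  by apply: hA => //; rewrite ltr_norml; lra.
by apply: ge0_subset_integral => //.
Qed.

(** * Box dimension from area bounds *)

Lemma ereal_inf_threshold (R : realType) (P : set R) (d : R) :
  (forall s, d < s -> P s) -> (forall s, s < d -> ~ P s) ->
  ereal_inf [set s%:E | s in P] = d%:E.
Proof.
move=> Pgt Plt; apply/eqP; rewrite eq_le; apply/andP; split.
  apply/lee_addgt0Pr => e e0; apply: ereal_inf_lbound; exists (d + e) => //.
  by apply: Pgt; rewrite ltrDl.
apply: le_ereal_inf_tmp => _ [s Ps <-]; rewrite lee_fin leNgt.
by apply/negP => /Plt.
Qed.

Section box_dimension_of_area_bounds.
Variables (R : realType) (B : set (R * R)) (d c C e0 : R).
Hypotheses (c0 : 0 < c) (C0 : 0 < C) (e00 : 0 < e0).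
Hypothesis areaB : forall e, 0 < e < e0 ->
  ((c * e `^ (2 - d))%:E <= area (eps_nbhd B e) <= (C * e `^ (2 - d))%:E)%E.

(** Dividing by [e^(2-s)] leaves [e^(s-d)], which tends to 0 for [s > d] and is at least 1 for
    [s < d] and [e < 1]. Hence [d] is the threshold for limsup and liminf alike. *)
Let ratio_bounds s e : 0 < e < e0 ->
  ((c * e `^ (s - d))%:E <= box_ratio B s e <= (C * e `^ (s - d))%:E)%E.
Proof.
move=> /andP[e_gt0 ee0]; have /andP[lo hi] := areaB _ (introT andP (conj e_gt0 ee0)).
have p0 : 0 < e `^ (2 - s) by exact: powR_gt0.
have -> : e `^ (s - d) = e `^ (2 - d) * (e `^ (2 - s))^-1.
  rewrite -powRN -powRD; last by rewrite (gt_eqF e_gt0) implybT.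
  by congr (_ `^ _); ring.
have split_ratio x : (x * (e `^ (2 - d) * (e `^ (2 - s))^-1))%:E =
    ((x * e `^ (2 - d))%:E * ((e `^ (2 - s))^-1)%:E)%E by rewrite mulrA EFinM.
rewrite /box_ratio !split_ratio.
by apply/andP; split; apply: lee_wpmul2r => //; rewrite lee_fin invr_ge0 ltW.
Qed.

Let ratio_ge0 s e : (0 <= box_ratio B s e)%E.
Proof.
rewrite /box_ratio mule_ge0 //.
by rewrite lee_fin invr_ge0 powR_ge0.
Qed.

Let ratio_small s eta : d < s -> 0 < eta ->
  exists2 del, 0 < del & forall e, 0 < e < del -> (box_ratio B s e <= eta%:E)%E.
Proof.
move=> ds eta0; have sd0 : 0 < s - d by rewrite subr_gt0.
(* The second bound is the solution of [C * e^(s-d) = eta]. *)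
exists (Num.min e0 ((eta / C) `^ (s - d)^-1)).
  by rewrite lt_min e00 powR_gt0 // divr_gt0.
move=> e /andP[e_gt0]; rewrite lt_min => /andP[ee0 eeta].
have /andP[_ hi] := ratio_bounds s _ (introT andP (conj e_gt0 ee0)).
apply: (le_trans hi); rewrite lee_fin -ler_pdivlMl // mulrC.
have -> : eta / C = ((eta / C) `^ (s - d)^-1) `^ (s - d).
  by rewrite -powRrM mulVf ?gt_eqF // powRr1 // ltW // divr_gt0.
by apply: ge0_ler_powR; rewrite ?nnegrE ?powR_ge0 // ltW.
Qed.

Let ratio_large s e : s < d -> 0 < e < Num.min e0 1 -> (c%:E <= box_ratio B s e)%E.
Proof.
move=> sd /andP[e_gt0]; rewrite lt_min => /andP[ee0 e1].
have /andP[+ _] := ratio_bounds s _ (introT andP (conj e_gt0 ee0)).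
apply: le_trans; rewrite lee_fin ler_peMr ?(ltW c0) //.
by rewrite -[X in X <= _](powRr0 e); apply: ger_powR; lra.
Qed.

Let mid (x : R) : 0 < x -> 0 < x / 2 < x.
Proof. by move=> x0; lra. Qed.

Lemma upper_box_dim_area_bounds : upper_box_dim B = d%:E.
Proof.
apply: ereal_inf_threshold => s sd /=.
  apply/eqP; rewrite eq_le; apply/andP; split.
    apply/lee_addgt0Pr => eta eta0; rewrite add0e.
    have [del del0 small] := ratio_small _ _ sd eta0.
    apply: (@le_trans _ _ (ereal_sup [set box_ratio B s e | e in [set e | 0 < e < del]])).
      by apply: ereal_inf_lbound; exists del.
    by apply: ge_ereal_sup => _ [e /= he <-]; exact: small.
  apply: le_ereal_inf_tmp => _ [del /= /mid hdel <-].
  apply: (le_trans (ratio_ge0 s (del / 2))).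
  by apply: ereal_sup_ubound; exists (del / 2).
apply/eqP; rewrite gt_eqF //; apply: (@lt_le_trans _ _ c%:E); first by rewrite lte_fin.
apply: le_ereal_inf_tmp => _ [del /= del0 <-].
(* A point of [(0, del)] at which the ratio is already known to be at least [c]. *)
pose e := Num.min del (Num.min e0 1) / 2.
have : 0 < e < Num.min del (Num.min e0 1) by apply: mid; rewrite !lt_min del0 e00 ltr01.
rewrite [in X in _ && X]lt_min => /and3P[e_gt0 edel eM].
apply: (@le_trans _ _ (box_ratio B s e)); first by apply: ratio_large => //; rewrite e_gt0.
by apply: ereal_sup_ubound; exists e => //=; rewrite e_gt0.
Qed.

Lemma lower_box_dim_area_bounds : lower_box_dim B = d%:E.
Proof.
apply: ereal_inf_threshold => s sd /=.
  apply/eqP; rewrite eq_le; apply/andP; split.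
    apply: ge_ereal_sup => _ [del /= del0 <-].
    apply/lee_addgt0Pr => eta eta0; rewrite add0e.
    have [del' del'0 small] := ratio_small _ _ sd eta0.
    pose e := Num.min del del' / 2.
    have : 0 < e < Num.min del del' by apply: mid; rewrite lt_min del0.
    rewrite [in X in _ && X]lt_min => /and3P[e_gt0 edel edel'].
    apply: (@le_trans _ _ (box_ratio B s e)); last by apply: small; rewrite e_gt0.
    by apply: ereal_inf_lbound; exists e => //=; rewrite e_gt0.
  apply: (@le_trans _ _ (ereal_inf [set box_ratio B s e | e in [set e | 0 < e < 1]])).
    by apply: le_ereal_inf_tmp => _ [e _ <-]; exact: ratio_ge0.
  by apply: ereal_sup_ubound; exists 1 => /=.
apply/eqP; rewrite gt_eqF //; apply: (@lt_le_trans _ _ c%:E); first by rewrite lte_fin.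
apply: (@le_trans _ _
  (ereal_inf [set box_ratio B s e | e in [set e | 0 < e < Num.min e0 1]])).
  by apply: le_ereal_inf_tmp => _ [e /= he <-]; exact: ratio_large.
by apply: ereal_sup_ubound; exists (Num.min e0 1) => //=; rewrite lt_min e00 ltr01.
Qed.

End box_dimension_of_area_bounds.

(** * Decay of solutions of the radial equation *)

(** The mean value theorem for [g - f]. It takes the place of integration in all later estimates. *)
Lemma le_increment (R : realType) (f g df dg : R -> R) (a b : R) : a <= b ->
  (forall x, a <= x <= b -> is_derive x 1 f (df x)) ->
  (forall x, a <= x <= b -> is_derive x 1 g (dg x)) ->
  (forall x, a <= x <= b -> df x <= dg x) -> f b - f a <= g b - g a.
Proof.
move=> ab hf hg le_d.
have hd x : x \in `[a, b] -> is_derive x 1 (g - f) (dg x - df x).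
  by rewrite in_itv /= => axb; have ? := hf x axb; have ? := hg x axb; exact: is_deriveB.
have cont : {within `[a, b], continuous (g - f)}.
  by apply: derivable_within_continuous => x /hd [].
have hd' x : x \in `]a, b[ -> is_derive x 1 (g - f) (dg x - df x).
  by move=> /subset_itv_oo_cc; exact: hd.
have [c cab] := MVT_segment ab hd' cont.
rewrite !fctE => e; rewrite -subr_ge0.
have -> : g b - g a - (f b - f a) = g b - f b - (g a - f a) by ring.
rewrite e mulr_ge0 ?subr_ge0 //; apply: le_d.
by move: cab; rewrite in_itv.
Qed.

Lemma norm_increment_le (R : realType) (f g df dg : R -> R) (a b : R) : a <= b ->
  (forall x, a <= x <= b -> is_derive x 1 f (df x)) ->
  (forall x, a <= x <= b -> is_derive x 1 g (dg x)) ->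
  (forall x, a <= x <= b -> `|df x| <= dg x) -> `|f b - f a| <= g b - g a.
Proof.
move=> ab hf hg le_d; rewrite ler_norml; apply/andP; split; last first.
  apply: (@le_increment _ f g df dg) => // x /le_d.
  exact: le_trans (ler_norm _).
rewrite lerNl.
suff : (- f) b - (- f) a <= g b - g a by rewrite !fctE; lra.
apply: (@le_increment _ _ g (fun x => - df x) dg) => // x axb.
  by have ? := hf x axb; exact: is_deriveN.
by apply: le_trans (le_d x axb); rewrite -normrN ler_norm.
Qed.

Lemma is_derive_affine (R : realType) (a c x : R) :
  is_derive x 1 (fun t => c + a * t) a.
Proof.
have -> : (fun t : R => c + a * t) = cst c + a *: id by apply/funext.
by apply: is_derive_eq; rewrite add0r scaler1.
Qed.

Section decay.
Variables (R : realType) (f q : R -> R) (t0 V M b : R) (k : nat).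
Hypothesis f_derive :
  forall t, t0 <= t -> is_derive t 1 f (- (f t ^+ (2 * k).+1 * q t)).
Hypothesis f_gt0 : forall t, t0 <= t -> 0 < f t.
Hypothesis f_le : forall t, t0 <= t -> f t <= V.
Hypothesis M_ge0 : 0 <= M.
Hypothesis q_close : forall t, t0 <= t -> `|q t - b| <= M * f t ^+ 2.
Hypothesis f_to0 :
  forall e : R, 0 < e -> exists2 t1, t0 <= t1 & forall t, t1 <= t -> f t < e.
Hypothesis b_neq0 : b != 0.

Lemma rate_eventually_close :
  exists2 t1, t0 <= t1 & forall t, t1 <= t -> `|q t - b| <= `|b| / 2.
Proof.
have b0 : 0 < `|b| by rewrite normr_gt0.
have M0 := M_ge0; have M1 : 0 < 2 * (M + 1) by lra.
(* The bound 1 gives [f^2 <= f], the other one [M * f <= |b| / 2]; [M + 1] avoids a zero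
   denominator. *)
have e0 : 0 < Num.min 1 (`|b| / (2 * (M + 1))) by rewrite lt_min ltr01 divr_gt0.
have [t1 t01 small] := f_to0 _ e0.
exists t1 => // t t1t; have tt : t0 <= t by lra.
apply: (le_trans (q_close _ tt)).
have := small t t1t; rewrite lt_min ltr_pdivlMr // => /andP[f1 fb].
have f0 := f_gt0 _ tt.
nra.
Qed.

(** If [b] were negative, [q] would be negative from some [t1] on, so [f] could not fall below
    [f t1] and would not tend to 0. *)
Lemma rate_limit_gt0 : 0 < b.
Proof.
rewrite lt_neqAle eq_sym b_neq0 leNgt; apply/negP => b0.
have [t1 t01 close] := rate_eventually_close.
have [t2 t02 small] := f_to0 _ (f_gt0 _ t01).
pose t := Num.max t1 t2.
have t1t : t1 <= t by rewrite le_max lexx.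
have t2t : t2 <= t by rewrite le_max lexx orbT.
have : cst 0 t - cst 0 t1 <= f t - f t1.
  apply: (@le_increment _ (cst 0) f (cst 0) (fun t => - (f t ^+ (2 * k).+1 * q t))) => //.
    by move=> x /andP[x1 x2]; apply: f_derive; lra.
  move=> x /andP[x1 x2]; have xx : t0 <= x by lra.
  rewrite /cst /= oppr_ge0 mulr_ge0_le0 ?exprn_ge0 ?ltW ?f_gt0 //.
  by have := close x x1; rewrite (ltr0_norm b0) ler_norml; lra.
rewrite /cst /= subrr subr_ge0 => ft; have := small t t2t; lra.
Qed.

Lemma rate_bounded t : t0 <= t -> `|q t| <= `|b| + M * V ^+ 2.
Proof.
move=> tt; rewrite -[q t](subrK b) addrC.
apply: (le_trans (ler_normD _ _)); rewrite lerD2l; apply: (le_trans (q_close _ tt)).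
rewrite ler_wpM2l // lerXn2r ?nnegrE ?f_le //.
  exact: ltW (f_gt0 _ tt).
exact: ltW (lt_le_trans (f_gt0 _ tt) (f_le _ tt)).
Qed.

Lemma rate_eventually_ge :
  exists2 t1, t0 <= t1 & forall t, t1 <= t -> b / 2 <= q t.
Proof.
have [t1 t01 close] := rate_eventually_close; exists t1 => // t /close.
by rewrite (gtr0_norm rate_limit_gt0) ler_norml; lra.
Qed.

(** Separation of variables: this power of [f] has a derivative in which [f] no longer appears
    explicitly. *)
Lemma is_derive_inv_pow t : t0 <= t ->
  is_derive t 1 (fun s => (f s)^-1 ^+ (2 * k)) ((2 * k)%:R * q t).
Proof.
move=> tt; have f0 := f_gt0 _ tt; have fn0 : f t != 0 by rewrite gt_eqF.
have := is_deriveX (2 * k) (is_deriveV fn0 (f_derive _ tt)).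
have -> : (fun y => (f y)^-1) ^+ (2 * k) = fun s => (f s)^-1 ^+ (2 * k).
  by apply/funext => s; rewrite exprfctE.
move=> H; apply: is_derive_eq.
(* For [k = 0] both sides vanish; otherwise [2 * k] is written with two successors so that the
   powers of [f] cancel. *)
case: k => [|n]; first by rewrite !mul0r scale0r.
have -> : (2 * n.+1)%N = (2 * n).+2 by rewrite mulnS.
rewrite /GRing.scale /= -mulrA; congr (_ * _).
have -> : f t ^+ (2 * n).+3 = f t ^+ 2 * f t ^+ (2 * n).+1.
  by rewrite -exprD.
rewrite mulrNN exprVn.
set P := f t ^+ (2 * n).+1; have P0 : P != 0 by rewrite expf_neq0.
by field; rewrite fn0 P0.
Qed.

(** The derivative [2 k q] of [H = f^(-2k)] is at most [K] everywhere and at least [b / 2] after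
    some [t1]; before [t1] only the bound [h <= H] is used. *)
Lemma algebraic_decay : (0 < k)%N -> exists c C : R, [/\ 0 < c, 0 < C &
  forall t, t0 <= t ->
    c * (t - t0 + 1) <= (f t)^-1 ^+ (2 * k) <= C * (t - t0 + 1)].
Proof.
move=> k0; have b0 := rate_limit_gt0.
have [t1 t01 q_ge] := rate_eventually_ge.
pose H := fun s => (f s)^-1 ^+ (2 * k).
have H_ge0 t : t0 <= t -> 0 < H t by move=> tt; rewrite exprn_gt0 // invr_gt0 f_gt0.
have V0 : 0 < V by apply: lt_le_trans (f_le _ (lexx t0)); exact: f_gt0.
pose h := V^-1 ^+ (2 * k).
have h0 : 0 < h by rewrite exprn_gt0 // invr_gt0.
have H_ge t : t0 <= t -> h <= H t.
  move=> tt; apply: lerXn2r; rewrite ?nnegrE ?invr_ge0 ?(ltW V0) //.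
    exact: ltW (f_gt0 _ tt).
  by rewrite lef_pV2 ?posrE ?f_gt0 ?f_le.
pose K := (2 * k)%:R * (`|b| + M * V ^+ 2).
have k2 : 1 <= (2 * k)%:R :> R by rewrite ler1n muln_gt0.
have K0 : 0 <= K by rewrite mulr_ge0 // addr_ge0 // mulr_ge0 // sqr_ge0.
(* The first bound keeps the line [c * (t - t0 + 1)] below [h] up to [t1], the second keeps its
   slope below that of [H] afterwards. *)
pose c := Num.min (h / (t1 - t0 + 1)) (b / 2).
have c0 : 0 < c by rewrite lt_min !divr_gt0 //; lra.
exists c, (Num.max K (H t0)); split => //.
  by rewrite lt_max H_ge0 ?orbT.
move=> t tt; apply/andP; split; last first.
  have : H t - H t0 <= (0 + K * t) - (0 + K * t0).
    apply: (@le_increment _ H (fun t => 0 + K * t) (fun t => (2 * k)%:R * q t) (fun=> K)) => //.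
    - by move=> x /andP[x1 _]; exact: is_derive_inv_pow.
    - by move=> x _; exact: is_derive_affine.
    move=> x /andP[x1 _]; rewrite ler_wpM2l //.
    exact: le_trans (ler_norm _) (rate_bounded _ x1).
  have m1 : K <= Num.max K (H t0) by rewrite le_max lexx.
  have m2 : H t0 <= Num.max K (H t0) by rewrite le_max lexx orbT.
  rewrite -/(H t); nra.
have c1 : c * (t1 - t0 + 1) <= h.
  by rewrite -ler_pdivlMr; [rewrite ge_min lexx|lra].
have c2 : c <= b / 2 by rewrite ge_min lexx orbT.
rewrite -/(H t); have [t1t|/ltW tt1] := leP t1 t; last first.
  by have := H_ge t tt; nra.
have : (0 + (b / 2) * t) - (0 + (b / 2) * t1) <= H t - H t1.
  apply: (@le_increment _ (fun t => 0 + b / 2 * t) H (fun=> b / 2) (fun t => (2 * k)%:R * q t)) => //.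
  - by move=> x _; exact: is_derive_affine.
  - by move=> x /andP[x1 _]; apply: is_derive_inv_pow; lra.
  move=> x /andP[x1 _]; have := q_ge x x1; nra.
have := H_ge t1 t01; nra.
Qed.

Hypothesis k_eq0 : k = 0%N.

Let f_ln_derive t : t0 <= t -> is_derive t 1 (@ln R \o f) (- q t).
Proof.
move=> tt; have f0 := f_gt0 _ tt.
have := is_derive1_comp (is_derive1_ln f0) (f_derive _ tt).
rewrite k_eq0 muln0 expr1 => H; apply: is_derive_eq.
by field; rewrite gt_eqF.
Qed.

(** Half the true rate, from [(ln f)' = - q <= - b / 2] for large [t]. This is enough to make the
    error [M * f^2] integrable and the inverted spiral of finite length. *)
Lemma exponential_decay : exists2 C : R, 0 < C &
  forall t, t0 <= t -> f t <= C * expR (- (b / 2) * t).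
Proof.
have b0 := rate_limit_gt0.
have [t1 t01 q_ge] := rate_eventually_ge.
have V0 : 0 < V by apply: lt_le_trans (f_le _ (lexx t0)); exact: f_gt0.
(* With this constant the right-hand side equals [V] at [t1] and is larger before. *)
exists (V * expR (b / 2 * t1)); first by rewrite mulr_gt0 ?expR_gt0.
move=> t tt; have expR_ln (x : R) : 0 < x -> x = expR (ln x).
  by move=> x0; rewrite lnK // posrE.
rewrite (expR_ln V V0) (expR_ln _ (f_gt0 _ tt)) -!expRD ler_expR.
have lnV s : t0 <= s -> ln (f s) <= ln V.
  by move=> ss; rewrite ler_ln ?posrE ?f_gt0 ?f_le.
have [t1t|/ltW tt1] := leP t1 t; last by have := lnV t tt; nra.
have : (@ln R \o f) t - (@ln R \o f) t1 <= (0 + - (b / 2) * t) - (0 + - (b / 2) * t1).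
  apply: (@le_increment _ (@ln R \o f) (fun t => 0 + - (b / 2) * t) (fun t => - q t) (fun=> - (b / 2))) => //.
  - by move=> x /andP[x1 _]; apply: f_ln_derive; lra.
  - by move=> x _; exact: is_derive_affine.
  by move=> x /andP[x1 _]; rewrite lerN2; exact: q_ge.
have := lnV t1 t01; rewrite /comp; lra.
Qed.

(** The derivative [b - q] of [ln f + b t] is at most [M * f^2] in absolute value, hence bounded by
    a multiple of the integrable function [e^(-b t)]. *)
Lemma exponential_asymptotics : exists C : R,
  forall t, t0 <= t -> `|ln (f t) + b * t| <= C.
Proof.
have b0 := rate_limit_gt0.
have [C C0 decay] := exponential_decay.
pose D := M * C ^+ 2 / b.
have D0 : 0 <= D by rewrite divr_ge0 ?(ltW b0) // mulr_ge0 // sqr_ge0.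
exists (`|ln (f t0) + b * t0| + D * expR (- b * t0)) => t tt.
pose L := fun s => ln (f s) + b * s.
(* A primitive of [M * C^2 * e^(-b s)], whose increments from [t0] are at most [D * e^(-b t0)]. *)
pose E := fun s : R => - D * expR (- b * s).
have : `|L t - L t0| <= E t - E t0.
  apply: (@norm_increment_le _ L E (fun s => - q s + b)
    (fun s => M * C ^+ 2 * expR (- b * s))) => //.
  - move=> x /andP[x1 _]; have ? := f_ln_derive _ x1.
    have ? := is_derive_affine _ b 0 x.
    have -> : L = (@ln R \o f) + (fun t => 0 + b * t).
      by apply/funext => s; rewrite !fctE /L add0r.
    exact: is_deriveD.
  - move=> x _.
    have H1 := is_derive_affine _ (- b) 0 x.
    have H2 := @is_derive1_comp R expR (fun t => 0 + - b * t) x _ _ (is_derive_expR _) H1.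
    have -> : E = - D *: (@expR R \o (fun t => 0 + - b * t)).
      by apply/funext => s; rewrite !fctE /E add0r.
    apply: is_derive_eq; rewrite /GRing.scale /= add0r /D.
    by field; rewrite gt_eqF.
  move=> x /andP[x1 _]; rewrite addrC -normrN opprD opprK addrC.
  apply: (le_trans (q_close _ x1)); rewrite -mulrA ler_wpM2l //.
  have -> : expR (- b * x) = expR (- (b / 2) * x) ^+ 2.
    by rewrite expr2 -expRD; congr expR; lra.
  rewrite -exprMn; apply: lerXn2r; rewrite ?nnegrE.
  - exact: ltW (f_gt0 _ x1).
  - exact: ltW (mulr_gt0 C0 (expR_gt0 _)).
  - exact: decay.
rewrite /L /E => LE.
have := ler_normD (ln (f t) + b * t - (ln (f t0) + b * t0)) (ln (f t0) + b * t0).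
rewrite subrK => /le_trans; apply.
have := expR_ge0 (- b * t); have := expR_ge0 (- b * t0); nra.
Qed.

End decay.

(** * Neighbourhoods of spirals *)

(** The sign [tau], 1 or -1, allows a reflection, so that a spiral whose angle tends to minus
    infinity is also parametrised by [t] tending to plus infinity. *)
Definition polar_curve {R : realType} (tau t0 : R) (f : R -> R) : set (R * R) :=
  [set (f t * cos t, tau * (f t * sin t)) | t in [set t | t0 <= t]].

Lemma edist_lt_coord (R : realType) (p z : R * R) (e : R) : 0 < e ->
  edist p z < e -> `|p.1 - z.1| < e /\ `|p.2 - z.2| < e.
Proof.
move=> e0; rewrite edist_lt // => h.
have lt_of_sq (a : R) : a ^+ 2 < e ^+ 2 -> `|a| < e.
  by move=> ae; rewrite -[e]gtr0_norm // -ltr_sqr ?nnegrE // !real_normK ?num_real.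
by split; apply: lt_of_sq; apply: le_lt_trans h; rewrite ?lerDl ?lerDr sqr_ge0.
Qed.

(* The curve is cut into pieces along which the length function S grows by less than e; each piece stays within e of any of its points. *)
Lemma eps_nbhd_rectifiable (R : realType) (D : set R) (x y S : R -> R) (L e : R) :
  0 < e ->
  (forall s t, D s -> D t -> s <= t -> `|x t - x s| <= S t - S s) ->
  (forall s t, D s -> D t -> s <= t -> `|y t - y s| <= S t - S s) ->
  (forall t, D t -> 0 <= S t <= L) ->
  exists p : nat -> R * R,
    eps_nbhd [set (x t, y t) | t in D] e `<=`
    \big[setU/set0]_(i < (Num.truncn (L / e)).+1) square (p i) (2 * e).
Proof.
move=> e0 hx hy hS.
pose piece (i : nat) := [set t | D t /\ Num.truncn (S t / e) = i].
(* Any parameter of the piece will do; the default 0 is taken only for an empty piece, from which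
   nothing has to be covered. *)
pose p i := let t := xget 0 (piece i) in (x t, y t).
exists p => z [_ [t Dt <-]] /(edist_lt_coord _ _ _ _ e0)[/= z1 z2].
have St0 u : D u -> 0 <= S u / e by move=> /hS /andP[S0 _]; rewrite divr_ge0 // ltW.
pose i := Num.truncn (S t / e).
have iL : (i < (Num.truncn (L / e)).+1)%N.
  rewrite ltnS; apply: le_truncn; have /andP[_ SL] := hS t Dt.
  by rewrite ler_pM2r ?invr_gt0.
rewrite -(bigcup_mkord _ (fun i => square (p i) (2 * e))); exists i => //.
have [Ds si] : piece i (xget 0 (piece i)) by apply: xgetPex; exists t.
rewrite /p; set s := xget 0 (piece i) in Ds si *.
have close (w : R -> R) :
    (forall s t, D s -> D t -> s <= t -> `|w t - w s| <= S t - S s) ->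
    `|w t - w s| < e.
  move=> hw; have := truncn_itv (St0 t Dt); have := truncn_itv (St0 s Ds).
  rewrite si -/i !ler_pdivlMr // !ltr_pdivrMr // -natr1 => /andP[a1 a2] /andP[a3 a4].
  have [st|/ltW ts] := leP s t.
    by apply: le_lt_trans (hw _ _ Ds Dt st) _; lra.
  by rewrite distrC; apply: le_lt_trans (hw _ _ Dt Ds ts) _; lra.
(* One [e] comes from the neighbourhood and one from the piece, whence the half side [2 * e]. *)
have := close x hx; have := close y hy; move: z1 z2; rewrite !ltr_norml.
move=> /andP[? ?] /andP[? ?] /andP[? ?] /andP[? ?].
by split; rewrite /= in_itv /=; apply/andP; split; lra.
Qed.

(** The angle [acos (x / r)] has sine [|y| / r]; the sign of [y] decides whether to negate it. *)
Lemma polar_angle (R : realType) (x y r : R) : 0 < r -> x ^+ 2 + y ^+ 2 = r ^+ 2 ->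
  exists theta, [/\ - pi <= theta <= pi, x = r * cos theta & y = r * sin theta].
Proof.
move=> r0 xyr.
have rn0 : r != 0 by rewrite gt_eqF.
have xr : -1 <= x / r <= 1.
  rewrite ler_pdivlMr // ler_pdivrMr //; apply/andP; split; nra.
have cosE : cos (acos (x / r)) = x / r by rewrite acosK.
have sinE : sin (acos (x / r)) = `|y| / r.
  rewrite sin_acos // -[RHS]ger0_norm ?divr_ge0 ?(ltW r0) // -sqrtr_sqr.
  congr Num.sqrt; rewrite !expr_div_n real_normK ?num_real // -[1](divff (expf_neq0 2 rn0)).
  by rewrite -mulrBl -xyr; congr (_ / _); ring.
have [a0 a1] : 0 <= acos (x / r) /\ acos (x / r) <= pi.
  by split; [exact: acos_ge0|exact: acos_lepi].
have p0 := @pi_gt0 R.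
have [y0|y0] := leP 0 y.
  exists (acos (x / r)); split; first by lra.
    by rewrite cosE mulrC divfK.
  by rewrite sinE ger0_norm // mulrC divfK.
exists (- acos (x / r)); split; first by lra.
  by rewrite cosN cosE mulrC divfK.
by rewrite sinN sinE ltr0_norm // mulNr opprK mulrC divfK.
Qed.

(* If consecutive turns of the spiral are less than e apart, every point of the inner disc lies between two turns. *)
Lemma square_sub_eps_nbhd (R : realType) (tau t0 T r0 e : R) (f : R -> R) :
  tau ^+ 2 = 1 -> t0 <= T -> pi <= T -> 0 < e -> 0 < r0 ->
  (forall t, t0 <= t -> 0 < f t) ->
  (forall t, T <= t -> f t - f (t + pi *+ 2) < e) ->
  (forall t, T <= t <= T + pi *+ 2 -> r0 <= f t) ->
  (forall d : R, 0 < d -> exists2 t1, t0 <= t1 & forall t, t1 <= t -> f t < d) ->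
  square (0, 0) (r0 / 2) `<=` eps_nbhd (polar_curve tau t0 f) e.
Proof.
move=> tau2 t0T piT e0 r00 fpos gap fr0 f0 [x y] [/=].
rewrite !in_itv /= !add0r => /andP[x1 x2] /andP[y1 y2].
have p0 := @pi_gt0 R.
have tp : 0 < pi *+ 2 :> R by rewrite pmulrn_lgt0.
pose r := Num.sqrt (x ^+ 2 + y ^+ 2).
have r2 : x ^+ 2 + y ^+ 2 = r ^+ 2 by rewrite sqr_sqrtr // addr_ge0 ?sqr_ge0.
(* The origin has no polar angle; it is close to any point far along the curve. *)
have [r_gt0|] := ltP 0 r; last first.
  move=> r_le0; have r_eq0 : r = 0 by apply/eqP; rewrite eq_le r_le0 sqrtr_ge0.
  have [t1 t01 small] := f0 e e0.
  exists (f t1 * cos t1, tau * (f t1 * sin t1)); first by exists t1.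
  rewrite edist_lt //=.
  have [x00 y00] : x = 0 /\ y = 0.
    move: r2; rewrite r_eq0 expr0n /= => /eqP.
    by rewrite paddr_eq0 ?sqr_ge0 // !sqrf_eq0 => /andP[/eqP -> /eqP ->].
  rewrite x00 y00 !sub0r !sqrrN !exprMn tau2 mul1r -mulrDr cos2Dsin2 mulr1.
  have := small t1 (lexx _); have := fpos t1 t01; nra.
have rr0 : r < r0 by nra.
have tau_r : x ^+ 2 + (tau * y) ^+ 2 = r ^+ 2 by rewrite exprMn tau2 mul1r.
have [th [thpi xE yE]] := polar_angle _ _ _ _ r_gt0 tau_r.
have T2 : 0 <= (T - th) / (pi *+ 2).
  apply: divr_ge0; last by rewrite mulrn_wge0 // ltW.
  by case/andP: thpi => _ ?; lra.
(* The first turn at angle [th] past [T], so that [ang 0] lies at most one turn beyond [T], where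
   the radius is at least [r0]. *)
pose n0 := (Num.truncn ((T - th) / (pi *+ 2))).+1.
pose ang n := th + pi *+ 2 *+ (n0 + n).
have angS n : ang n.+1 = ang n + pi *+ 2 by rewrite /ang addnS mulrSr addrA.
have ang0 : T <= ang 0%N <= T + pi *+ 2.
  have := truncn_itv T2; rewrite (ler_pdivlMr _ _ tp) (ltr_pdivrMr _ _ tp).
  rewrite /ang addn0 /n0 -natr1 -[(pi *+ 2) *+ _]mulr_natl -natr1.
  by move=> /andP[? ?]; apply/andP; split; lra.
have angT n : T <= ang n.
  elim: n => [|n IH]; first by case/andP: ang0.
  by rewrite angS; apply: le_trans IH _; rewrite lerDl mulrn_wge0 ?ltW.
have cosang n : cos (ang n) = cos th by rewrite /ang periodicn //; exact: cosD2pi.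
have sinang n : sin (ang n) = sin th by rewrite /ang periodicn //; exact: sinD2pi.
have [N Nr] : exists n, f (ang n) < r.
  have [t1 t01 small] := f0 r r_gt0.
  pose m := (Num.truncn (t1 - th)).+1; exists m; apply: small.
  have pi2 := pi_ge2 R; have ha : t1 - th < m%:R := truncnS_gt (t1 - th).
  have -> : ang m = th + 2 * pi * (n0%:R + m%:R).
    by rewrite /ang -[X in _ + X]mulr_natl -[pi *+ 2]mulr_natl natrD; ring.
  have n00 : 0 <= n0%:R :> R by [].
  have m0 : 0 <= m%:R :> R by [].
  nra.
have ex : exists n, f (ang n) < r by exists N.
(* The least turn of radius below [r] is not turn 0, and its predecessor has radius at least [r].
   The gap between these two is less than [e], so the predecessor is within [e] of the point. *)
have := ex_minnP ex; case => -[|n] nr nmin.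
  by have := fr0 _ ang0; lra.
have rn : r <= f (ang n) by rewrite leNgt; apply/negP => /nmin; rewrite ltnn.
exists (f (ang n) * cos (ang n), tau * (f (ang n) * sin (ang n))).
  by exists (ang n) => //=; exact: le_trans (angT n).
rewrite edist_lt //= cosang sinang.
have -> : y = tau * (r * sin th) by rewrite -yE mulrA -expr2 tau2 mul1r.
rewrite -mulrBr exprMn tau2 mul1r xE -!mulrBl !exprMn -mulrDr cos2Dsin2 mulr1.
have := gap _ (angT n); rewrite -angS; nra.
Qed.

(** Each coordinate has speed at most [|f'| + |f|], so a primitive [S] of a bound for this sum can
    serve as length function in the covering lemma. *)
Lemma polar_increments (R : realType) (tau t0 : R) (f df S dS : R -> R) :
  tau ^+ 2 = 1 ->
  (forall t, t0 <= t -> is_derive t 1 f (df t)) ->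
  (forall t, t0 <= t -> is_derive t 1 S (dS t)) ->
  (forall t, t0 <= t -> `|df t| + `|f t| <= dS t) ->
  forall s t, t0 <= s -> s <= t ->
  `|f t * cos t - f s * cos s| <= S t - S s /\
  `|tau * (f t * sin t) - tau * (f s * sin s)| <= S t - S s.
Proof.
move=> tau2 hf hS hle s t t0s st.
have tau1 : `|tau| = 1.
  by apply/eqP; rewrite -sqrp_eq1 // real_normK ?num_real // tau2.
have cos1 x : `|cos x| <= 1 :> R by rewrite ler_norml cos_geN1 cos_le1.
have sin1 x : `|sin x| <= 1 :> R by rewrite ler_norml sin_geN1 sin_le1.
split.
  apply: (@norm_increment_le _ (fun t => f t * cos t) S
    (fun t => f t * - sin t + cos t * df t) dS) => //.
  - move=> x /andP[x1 _]; have t0x : t0 <= x by exact: le_trans x1.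
    have ? := hf x t0x.
    exact: (@is_deriveM _ _ f cos).
  - by move=> x /andP[x1 _]; apply: hS; exact: le_trans x1.
  move=> x /andP[x1 _]; have t0x : t0 <= x by exact: le_trans x1.
  apply: le_trans (hle x t0x); apply: (le_trans (ler_normD _ _)).
  rewrite addrC !normrM normrN lerD // ?ler_piMl ?ler_piMr //.
apply: (@norm_increment_le _ (fun t => tau * (f t * sin t)) S
  (fun t => tau * (f t * cos t + sin t * df t)) dS) => //.
- move=> x /andP[x1 _]; have t0x : t0 <= x by exact: le_trans x1.
  have ? := hf x t0x.
  have H := @is_deriveM _ _ f sin x 1 _ _ _ _.
  exact: (@is_deriveZ _ _ _ (f * sin) tau).
- by move=> x /andP[x1 _]; apply: hS; exact: le_trans x1.
move=> x /andP[x1 _]; have t0x : t0 <= x by exact: le_trans x1.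
rewrite normrM tau1 mul1r.
apply: le_trans (hle x t0x); apply: (le_trans (ler_normD _ _)).
rewrite addrC !normrM lerD // ?ler_piMl ?ler_piMr //.
Qed.

(** Above: finite length, covered by about [L / e] squares of side [4 * e]. Below: the projection of
    the curve to the first axis contains an interval. *)
Lemma area_bounds_exponential (R : realType) (tau t0 C kappa K : R) (f df : R -> R) :
  tau ^+ 2 = 1 -> 0 < C -> 0 < kappa -> 0 <= K ->
  (forall t, t0 <= t -> 0 < f t) ->
  (forall t, t0 <= t -> is_derive t 1 f (df t)) ->
  (forall t, t0 <= t -> f t <= C * expR (- kappa * t)) ->
  (forall t, t0 <= t -> `|df t| <= K * f t) ->
  exists c C' : R, [/\ 0 < c, 0 < C' & forall e, 0 < e < 1 ->
    ((c * e)%:E <= area (eps_nbhd (polar_curve tau t0 f) e) <= (C' * e)%:E)%E].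
Proof.
move=> tau2 C0 k0 K0 fpos hf fle dfle.
pose D := (K + 1) * C / kappa.
have D0 : 0 < D by rewrite divr_gt0 // mulr_gt0 //; lra.
pose S t := D * (expR (- kappa * t0) - expR (- kappa * t)).
have hS t : t0 <= t -> is_derive t 1 S (D * (kappa * expR (- kappa * t))).
  move=> tt; have H1 := is_derive_affine _ (- kappa) 0 t.
  have H2 := @is_derive1_comp R expR (fun t => 0 + - kappa * t) t _ _ (is_derive_expR _) H1.
  have -> : S = D *: (cst (expR (- kappa * t0)) - (expR \o (fun t => 0 + - kappa * t))).
    by apply/funext => s; rewrite !fctE /S /= add0r.
  by apply: is_derive_eq; rewrite /GRing.scale /= !add0r; ring.
have speed t : t0 <= t -> `|df t| + `|f t| <= D * (kappa * expR (- kappa * t)).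
  move=> tt; rewrite (gtr0_norm (fpos t tt)).
  have -> : D * (kappa * expR (- kappa * t)) = (K + 1) * (C * expR (- kappa * t)).
    by rewrite /D; field; rewrite gt_eqF.
  have := fle t tt; have := dfle t tt; nra.
have incr := polar_increments _ tau t0 f df S _ tau2 hf hS speed.
pose L := D * expR (- kappa * t0).
have L0 : 0 < L by rewrite mulr_gt0 ?expR_gt0.
have p0 := @pi_gt0 R; have p2 := pi_ge2 R.
pose n0 := (Num.truncn `|t0|).+1.
(* A multiple of [2 pi] beyond [t0]: the abscissa is [f ta] there and 0 a quarter turn later, so it
   takes all values between. *)
pose ta : R := 0 + pi *+ 2 *+ n0.
have t0ta : t0 <= ta.
  have h : `|t0| < n0%:R := truncnS_gt `|t0|.
  rewrite /ta add0r -mulr_natl -[pi *+ 2]mulr_natl.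
  have := ler_norm t0; have : 0 <= n0%:R :> R by []; nra.
have cta : cos ta = 1 by rewrite /ta (periodicn (@cosD2pi R)) cos0.
have sta : sin ta = 0 by rewrite /ta (periodicn (@sinD2pi R)) sin0.
pose x t := f t * cos t.
have xa : x ta = f ta.
  by rewrite /x cta mulr1.
have xb : x (ta + pi / 2) = 0.
  rewrite /x cosD cos_pihalf sta.
  by rewrite mulr0 mul0r subrr mulr0.
have fa := fpos ta t0ta.
have onto v : 0 <= v <= f ta -> exists t, t0 <= t /\ x t = v.
  move=> /andP[v0 va].
  have [|||t] := @IVT _ x ta (ta + pi / 2) v.
  - by rewrite lerDl divr_ge0 ?ltW.
  - apply: derivable_within_continuous => t; rewrite in_itv /= => /andP[tat _].
    have ? := hf t (le_trans t0ta tat).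
    exact: (@ex_derive _ _ _ _ _ _ _ (@is_deriveM _ _ f cos t 1 _ _ _ _)).
  - by rewrite xa xb ge_min v0 orbT le_max va.
  by rewrite in_itv /= => /andP[tat _] xt; exists t; split => //; exact: le_trans tat.
pose tm v := xget 0 [set t | t0 <= t /\ x t = v].
(* At most [L / e + 1] squares of area [16 * e^2] are used, and [e < 1]. *)
exists (2 * f ta), (16 * (L + 1)); split; [by rewrite mulr_gt0|lra|].
move=> e /andP[e0 e1].
have mN := eps_nbhd_measurable _ (polar_curve tau t0 f) _ e0.
apply/andP; split.
  have -> : 2 * f ta * e = (f ta - 0) * (2 * e) by ring.
  apply: (area_ge_projection _ _ _ _ _ (fun v => tau * (f (tm v) * sin (tm v)))) => //.
  move=> v z hv hz.
  have [ttm xtm] : t0 <= tm v /\ x (tm v) = v by exact: (xgetPex 0 (onto v hv)).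
  exists (f (tm v) * cos (tm v), tau * (f (tm v) * sin (tm v))).
    by exists (tm v).
  rewrite edist_lt //= -/(x (tm v)) xtm subrr expr0n add0r.
  by rewrite -real_normK ?num_real // ltr_pXn2r ?nnegrE // ltW.
have [|||p cover] := @eps_nbhd_rectifiable R [set t | t0 <= t] (fun t => f t * cos t)
    (fun t => tau * (f t * sin t)) S L e e0.
- by move=> s t /= t0s _ st; case: (incr s t t0s st).
- by move=> s t /= t0s _ st; case: (incr s t t0s st).
- move=> t /= tt; apply/andP; split.
    by apply: mulr_ge0; [exact: ltW|rewrite subr_ge0 ler_expR; nra].
  by rewrite ler_pM2l // lerBlDr lerDl expR_ge0.
have e2 : 0 < 2 * e by lra.
have := area_le_squares _ _ (fun=> 2 * e) _ p (fun=> e2) mN cover.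
move=> /le_trans; apply; rewrite lee_fin sumr_const card_ord -[X in X <= _]mulr_natl -[X in X * _]natr1.
have Le0 : 0 <= L / e by apply: divr_ge0; exact: ltW.
have /andP[h _] := truncn_itv Le0.
have : (Num.truncn (L / e))%:R * e <= L by rewrite -ler_pdivlMr.
nra.
Qed.

(** * Area bounds for spirals of power type *)

Lemma powRN_anti (R : realType) (x y a : R) : 0 < x -> x <= y -> 0 <= a ->
  y `^ (- a) <= x `^ (- a).
Proof.
move=> x0 xy a0; have y0 : 0 < y by exact: lt_le_trans xy.
rewrite !powRN lef_pV2 ?posrE ?powR_gt0 //.
by apply: ge0_ler_powR; rewrite ?nnegrE // ltW.
Qed.

(** The spiral is split where [u = t - t0 + 1] is of order [U = e^(-1/(1+alpha))], with radius of
    order [g = U^(-alpha)]. There [e * U^(1-alpha) = g^2], so the strip around the outer part and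
    the inner disc have areas of the same order. *)
Lemma area_bounds_algebraic (R : realType) (tau t0 alpha c C K : R) (f df : R -> R) :
  tau ^+ 2 = 1 -> 0 < alpha < 1 -> 0 < c -> 0 < C -> 0 <= K ->
  (forall t, t0 <= t -> is_derive t 1 f (df t)) ->
  (forall t, t0 <= t -> c * (t - t0 + 1) `^ (- alpha) <= f t) ->
  (forall t, t0 <= t -> f t <= C * (t - t0 + 1) `^ (- alpha)) ->
  (forall t, t0 <= t -> `|df t| <= K * (t - t0 + 1) `^ (- (1 + alpha))) ->
  (forall d : R, 0 < d -> exists2 t1, t0 <= t1 & forall t, t1 <= t -> f t < d) ->
  exists c' C' e0 : R, [/\ 0 < c', 0 < C', 0 < e0 & forall e, 0 < e < e0 ->
    ((c' * e `^ (2 - 2 / (1 + alpha)))%:E <= area (eps_nbhd (polar_curve tau t0 f) e)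
     <= (C' * e `^ (2 - 2 / (1 + alpha)))%:E)%E].
Proof.
move=> tau2 /andP[al0 al1] c0 C0 K0 hf fge fle dfle f0.
have p0 := @pi_gt0 R.
have pi2E : pi *+ 2 = 2 * pi :> R by rewrite mulr_natl.
have a1 : 0 < 1 + alpha by lra.
pose u t := t - t0 + 1.
have u1 t : t0 <= t -> 1 <= u t by rewrite /u; lra.
have fpos t : t0 <= t -> 0 < f t.
  move=> tt; apply: lt_le_trans (fge t tt); rewrite mulr_gt0 // powR_gt0 //.
  by rewrite -/(u t); have := u1 t tt; lra.
pose D := (K + C) / (1 - alpha).
have D0 : 0 < D by rewrite divr_gt0 //; lra.
pose S t := D * u t `^ (1 - alpha).
have hS t : t0 <= t -> is_derive t 1 S ((K + C) * u t `^ (- alpha)).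
  move=> tt; have H1 := is_derive_affine _ 1 (1 - t0) t.
  have ut : 1 - t0 + 1 * t = u t by rewrite /u; ring.
  have u0 : 0 < 1 - t0 + 1 * t by rewrite ut; have := u1 t tt; lra.
  have H2 := @is_derive1_comp R (fun x => x `^ (1 - alpha)) (fun t => 1 - t0 + 1 * t)
    t _ _ (is_derive1_powR (1 - alpha) u0) H1.
  have -> : S = D *: ((fun x => x `^ (1 - alpha)) \o (fun t => 1 - t0 + 1 * t)).
    by apply/funext => s; rewrite !fctE /S /u /=; congr (D * _ `^ _); ring.
  apply: is_derive_eq; rewrite /GRing.scale /= ut mulr1.
  have -> : 1 - alpha - 1 = - alpha by ring.
  by rewrite /D; field; lra.
have speed t : t0 <= t -> `|df t| + `|f t| <= (K + C) * u t `^ (- alpha).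
  move=> tt; rewrite (gtr0_norm (fpos t tt)) mulrDl lerD ?fle //.
  apply: le_trans (dfle t tt) _; rewrite ler_wpM2l // ler_powR ?u1 //; lra.
have incr := polar_increments _ tau t0 f df S _ tau2 hf hS speed.
(* Chosen so that [(A U)^(-(1+alpha)) = e / (2 pi K + 1)]: past [u = A U] the radius then drops by
   less than [e] in one turn. *)
pose A := (2 * pi * K + 1) `^ (1 + alpha)^-1.
have piK : 1 <= 2 * pi * K + 1 by rewrite lerDr mulr_ge0 // mulr_ge0 // ltW.
have A1 : 1 <= A.
  rewrite -[X in X <= _](powRr0 (2 * pi * K + 1)) ler_powR // invr_ge0.
  exact: ltW.
(* The restriction [e < B^(-(1+alpha))] gives [B <= U], which makes the starting parameter [T] of
   the inner part at least [pi]. *)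
pose B := pi + 2 + `|t0|.
have B0 : 0 < B by have := normr_ge0 t0; rewrite /B; lra.
(* During the turn that follows [T], [u <= A U + 2 pi <= (A + 2 pi) U], so [f] is at least
   [c1 * g]. *)
pose c1 := c * (A + 2 * pi) `^ (- alpha).
have A2 : 0 < A + 2 * pi by lra.
have c10 : 0 < c1 by rewrite mulr_gt0 // powR_gt0.
(* In units of [g^2]: the inner square of side [c1 * g]; the small squares, of total area at most
   [16 * (L e + e^2)] with [L e = D g^2]; and the large square of half side
   [C g + e <= (C + 1) g]. *)
exists (c1 ^+ 2), (16 * (D + 1) + 4 * (C + 1) ^+ 2), (Num.min 1 (B `^ (- (1 + alpha)))).
split; first by rewrite exprn_gt0.
  by rewrite addr_gt0 // mulr_gt0 ?exprn_gt0 //; lra.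
  by rewrite lt_min ltr01 powR_gt0.
move=> e /andP[e0]; rewrite lt_min => /andP[e1 eB].
pose U := e `^ (- (1 + alpha)^-1).
pose g := e `^ (alpha / (1 + alpha)).
have U0 : 0 < U by exact: powR_gt0.
have g0 : 0 < g by exact: powR_gt0.
have eE x y : e `^ x * e `^ y = e `^ (x + y).
  by rewrite powRD // (gt_eqF e0) implybT.
have a1n : 1 + alpha != 0 by rewrite gt_eqF.
have UE x : U `^ x = e `^ (- x / (1 + alpha)).
  by rewrite /U -powRrM; congr (_ `^ _); ring.
have e_powR1 : e `^ 1 = e by rewrite powRr1 // ltW.
have Ug : U `^ (- alpha) = g by rewrite UE opprK.
have Ue : U `^ (- (1 + alpha)) = e by rewrite UE opprK divff.
have eU : e * U `^ (1 - alpha) = g ^+ 2.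
  rewrite -[X in X * _]e_powR1 UE expr2 !eE; congr (_ `^ _); by field.
have -> : e `^ (2 - 2 / (1 + alpha)) = g ^+ 2.
  by rewrite expr2 !eE; congr (_ `^ _); field.
have U1 : 1 <= U.
  rewrite -[X in X <= _](powRr0 e); apply: ger_powR; first by rewrite e0 ltW.
  by rewrite oppr_le0 invr_ge0 ltW.
have eg : e <= g.
  by apply: ger1_powR; [rewrite e0 ltW|rewrite ler_pdivrMr //; lra].
have BU : B <= U.
  have : e `^ (1 + alpha)^-1 <= (B `^ (- (1 + alpha))) `^ (1 + alpha)^-1.
    by apply: ge0_ler_powR; rewrite ?nnegrE ?invr_ge0 ?powR_ge0 // ltW.
  rewrite -powRrM mulNr divff // powR_inv1 ?(ltW B0) // => h.
  by rewrite /U powRN -[B]invrK lef_pV2 ?posrE ?invr_gt0 ?powR_gt0.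
have mN := eps_nbhd_measurable _ (polar_curve tau t0 f) _ e0.
apply/andP; split.
  pose T := t0 - 1 + A * U.
  have AU : U <= A * U by rewrite ler_peMl // ltW.
  have AUe : (A * U) `^ (- (1 + alpha)) = (2 * pi * K + 1)^-1 * e.
    rewrite powRM ?(ltW U0) ?powR_ge0 // Ue; congr (_ * _).
    by rewrite /A -powRrM mulrN mulVf // powR_inv1 //; lra.
  have := ler_norm t0; have := ler_norm (- t0); rewrite normrN => tn1 tn2.
  have uT t : T <= t -> A * U <= u t by rewrite /T /u; lra.
  have t0T : t0 <= T by rewrite /T; lra.
  have r0 : 0 < c1 * g by rewrite mulr_gt0.
  have sub := square_sub_eps_nbhd _ tau t0 T (c1 * g) e f tau2 t0T _ e0 r0 fpos _ _ f0.
  apply: (@le_trans _ _ (area (square (0, 0) (c1 * g / 2)))).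
    rewrite area_square ?divr_gt0 // lee_fin.
    by rewrite le_eqVlt; apply/orP; left; apply/eqP; field.
  apply: area_le => //; first exact: square_measurable.
  apply: sub; first by move: BU; rewrite /T /B; lra.
  - move=> t Tt; pose G := K * ((2 * pi * K + 1)^-1 * e).
    have : `|f (t + pi *+ 2) - f t| <= (0 + G * (t + pi *+ 2)) - (0 + G * t).
      apply: (@norm_increment_le _ f (fun t => 0 + G * t) df (fun=> G)) => //.
      + by rewrite lerDl mulrn_wge0 // ltW.
      + by move=> x /andP[x1 _]; apply: hf; lra.
      + by move=> x _; exact: is_derive_affine.
      move=> x /andP[x1 _]; have t0x : t0 <= x by lra.
      apply: le_trans (dfle x t0x) _; rewrite ler_wpM2l // -AUe.
      apply: powRN_anti; [exact: lt_le_trans AU|apply: uT; lra|exact: ltW].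
    have -> : 0 + G * (t + pi *+ 2) - (0 + G * t) = 2 * pi * K / (2 * pi * K + 1) * e.
      by rewrite pi2E /G; ring.
    rewrite distrC => h; apply: le_lt_trans (ler_norm _) _; apply: le_lt_trans h _.
    rewrite -[X in _ < X]mul1r ltr_pM2r // ltr_pdivrMr; lra.
  move=> t /andP[Tt tT]; have t0t : t0 <= t by exact: le_trans Tt.
  apply: le_trans (fge t t0t); rewrite /c1 -mulrA ler_pM2l // -Ug -powRM ?(ltW U0) ?(ltW A2) //.
  apply: powRN_anti; [by have := u1 t t0t; rewrite /u; lra| |exact: ltW].
  move: tT; rewrite /T pi2E => tT; nra.
pose L := D * U `^ (1 - alpha).
have L0 : 0 < L by rewrite mulr_gt0 // powR_gt0.
have [|||p cover] := @eps_nbhd_rectifiable R [set t | t0 <= t /\ u t <= U]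
    (fun t => f t * cos t) (fun t => tau * (f t * sin t)) S L e e0.
- by move=> s t /= [t0s _] _ st; case: (incr s t t0s st).
- by move=> s t /= [t0s _] _ st; case: (incr s t t0s st).
- move=> t /= [tt uU]; have := u1 t tt => u1t; apply/andP; split.
    by rewrite mulr_ge0 ?powR_ge0 // ltW.
  rewrite ler_pM2l //; apply: ge0_ler_powR; rewrite ?nnegrE //; lra.
set N := (Num.truncn (L / e)).+1 in cover.
(* Index [N] carries the large square around the origin, which covers the part with [u > U]. *)
pose p' i := if (i < N)%N then p i else (0, 0).
pose h i := if (i < N)%N then 2 * e else C * g + e.
have h0 i : 0 < h i.
  by rewrite /h; case: ifP => _; [lra|rewrite addr_gt0 // mulr_gt0].
have cover' : eps_nbhd (polar_curve tau t0 f) e `<=`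
    \big[setU/set0]_(i < N.+1) square (p' i) (h i).
  rewrite big_ord_recr /= => z [_ [t /= tt <-] zt].
  have [uU|Uu] := leP (u t) U; [left|right].
    have -> : \big[setU/set0]_(i < N) square (p' i) (h i) =
              \big[setU/set0]_(i < N) square (p i) (2 * e).
      by apply: eq_bigr => i _; rewrite /p' /h ltn_ord.
    by apply: cover; exists (f t * cos t, tau * (f t * sin t)) => //; exists t.
  rewrite /p' /h ltnn.
  have [z1 z2] := edist_lt_coord _ _ _ _ e0 zt.
  have fg : f t <= C * g.
    apply: le_trans (fle t tt) _; rewrite ler_pM2l // -Ug.
    by apply: powRN_anti => //; exact: ltW.
  have ft := fpos t tt.
  have tau1 : `|tau| = 1.
    by apply/eqP; rewrite -sqrp_eq1 // real_normK ?num_real // tau2.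
  have b1 : `|f t * cos t| <= C * g.
    rewrite normrM (gtr0_norm ft); apply: le_trans fg.
    by rewrite ler_piMr ?(ltW ft) // ler_norml cos_geN1 cos_le1.
  have b2 : `|tau * (f t * sin t)| <= C * g.
    rewrite !normrM tau1 mul1r (gtr0_norm ft); apply: le_trans fg.
    by rewrite ler_piMr ?(ltW ft) // ler_norml sin_geN1 sin_le1.
  move: z1 z2 b1 b2 => /=; rewrite !ltr_norml !ler_norml.
  move=> /andP[? ?] /andP[? ?] /andP[? ?] /andP[? ?].
  by split; rewrite /= in_itv /=; apply/andP; split; lra.
have := area_le_squares _ _ h _ p' h0 mN cover'.
move=> /le_trans; apply; rewrite lee_fin big_ord_recr /= {2}/h ltnn.
rewrite (eq_bigr (fun=> 4 * (2 * e) ^+ 2)); last by move=> i _; rewrite /h ltn_ord.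
rewrite sumr_const card_ord -[_ *+ N]mulr_natl.
have -> : N%:R = (Num.truncn (L / e))%:R + 1 :> R by rewrite natr1.
have Le0 : 0 <= L / e by apply: divr_ge0; exact: ltW.
have /andP[tr _] := truncn_itv Le0.
have Ne : (Num.truncn (L / e))%:R * e <= L by rewrite -ler_pdivlMr.
have Le : L * e = D * g ^+ 2 by rewrite -eU /L; ring.
have Cg : (C * g + e) ^+ 2 <= (C + 1) ^+ 2 * g ^+ 2.
  by rewrite -exprMn; apply: lerXn2r; rewrite ?nnegrE; nra.
have ee : e ^+ 2 <= g ^+ 2 by apply: lerXn2r; rewrite ?nnegrE // ltW.
have Nee : (Num.truncn (L / e))%:R * e * e <= L * e by rewrite ler_pM2r.
lra.
Qed.

(** * The Hopf-Takens system at infinity *)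

Definition orient (R : realType) (up : bool) : R := if up then 1 else -1.

Lemma orient_sqr (R : realType) (up : bool) : orient R up ^+ 2 = 1.
Proof. by rewrite /orient; case: up; rewrite ?sqrrN expr1n. Qed.

Lemma orientK (R : realType) (up : bool) (x : R) :
  orient R up * (orient R up * x) = x.
Proof. by rewrite mulrA -expr2 orient_sqr mul1r. Qed.

Lemma angle_rangeE (R : realType) (up : bool) (phi0 phi : R) :
  angle_range up phi0 phi <-> orient R up * phi0 <= orient R up * phi.
Proof.
by rewrite /angle_range /orient; case: up => /=; rewrite ?mul1r // !mulN1r lerN2.
Qed.

(** Inversion keeps the angle and inverts the radius; substituting [phi = s * t] changes the sine by
    the sign [s], which becomes [tau]. *)
Lemma inversion_spiral (R : realType) (up : bool) (phi0 : R) (F : R -> R) :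
  (forall phi, angle_range up phi0 phi -> 0 < F phi) ->
  inversion @` spiral up phi0 F =
  polar_curve (orient R up) (orient R up * phi0) (fun t => (F (orient R up * t))^-1).
Proof.
move=> F0; set s := orient R up.
have cs x : cos (s * x) = cos x :> R.
  by rewrite /s /orient; case: (up); rewrite ?mul1r // mulN1r cosN.
have sn x : sin (s * x) = s * sin x :> R.
  by rewrite /s /orient; case: (up); rewrite ?mul1r // !mulN1r sinN.
have invE phi : 0 < F phi -> inversion (F phi * cos phi, F phi * sin phi) =
    ((F phi)^-1 * cos phi, (F phi)^-1 * sin phi).
  move=> Fp; rewrite /inversion /= !exprMn -mulrDr cos2Dsin2 mulr1.
  by congr pair; field; rewrite gt_eqF.
apply/seteqP; split => [_ [_ [phi hphi <-] <-]|_ [t /= ht <-]].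
  exists (s * phi); first exact/angle_rangeE.
  by rewrite invE ?F0 // cs sn orientK [s * (_ * (_ * _))]mulrCA orientK.
have hphi : angle_range up phi0 (s * t) by apply/angle_rangeE; rewrite orientK.
exists (F (s * t) * cos (s * t), F (s * t) * sin (s * t)); first by exists (s * t).
by rewrite invE ?F0 // cs sn [s * (_ * _)]mulrCA.
Qed.

(** The ball of radius [m / 2], a square in the product metric, lies inside the Euclidean disc of
    radius [m]. *)
Lemma closure_spiral (R : realType) (up : bool) (phi0 m : R) (F : R -> R) :
  0 < m -> (forall phi, angle_range up phi0 phi -> m <= F phi) ->
  ~ closure (spiral up phi0 F) (0, 0).
Proof.
move=> m0 Fm /(_ (ball (0 : R, 0 : R) (m / 2))) [].
  by apply: nbhsx_ballx; rewrite divr_gt0.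
move=> _ [[phi hphi <-] [/=]]; rewrite /ball /= !sub0r !normrN !ltr_norml.
move=> /andP[x1 x2] /andP[y1 y2].
have mF := Fm phi hphi.
have : (F phi * cos phi) ^+ 2 + (F phi * sin phi) ^+ 2 < m ^+ 2 by nra.
by rewrite !exprMn -[X in X < _]mulrDr cos2Dsin2; nra.
Qed.

Lemma polar_curve_bounded (R : realType) (tau t0 V : R) (f : R -> R) :
  tau ^+ 2 = 1 -> (forall t, t0 <= t -> 0 < f t) -> (forall t, t0 <= t -> f t <= V) ->
  exists M : R, forall p, polar_curve tau t0 f p -> edist p (0, 0) <= M.
Proof.
move=> tau2 f0 fV; exists (V + 1) => _ [t /= tt <-]; apply: ltW.
have ft := f0 t tt; have fv := fV t tt.
rewrite edist_lt /=; last by lra.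
by rewrite !subr0 !exprMn tau2 mul1r -mulrDr cos2Dsin2 mulr1; nra.
Qed.

Lemma has_box_dim_area_bounds (R : realType) (B : set (R * R)) (d c C e0 : R) :
  B !=set0 -> (exists M : R, forall p, B p -> edist p (0, 0) <= M) ->
  0 < c -> 0 < C -> 0 < e0 ->
  (forall e : R, 0 < e < e0 ->
   ((c * e `^ (2 - d))%:E <= area (eps_nbhd B e) <= (C * e `^ (2 - d))%:E)%E) ->
  has_box_dim B d.
Proof.
move=> B0 Bb c0 C0 e00 h; do 3?split => //.
  exact: upper_box_dim_area_bounds c0 C0 e00 h.
exact: lower_box_dim_area_bounds c0 C0 e00 h.
Qed.

(** Factoring out the lowest nonzero power leaves a polynomial [Q], bounded term by term. Through
    [acoef] the leading power becomes the term [j = l], so [k = l] is no special case. *)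
Lemma rhs_expansion (R : realType) (l : nat) (a : nat -> R) (k : nat) (V : R) :
  (k <= l)%N -> (forall j, (j < k)%N -> a j = 0) ->
  exists (Q : R -> R) (M : R), [/\ 0 <= M,
    (forall v, 0 <= v <= V -> `|Q v| <= M) &
    (forall v, v ^+ (2 * l) + \sum_(j < l) a j * v ^+ (2 * j) =
               v ^+ (2 * k) * (acoef l a k + v ^+ 2 * Q v))].
Proof.
move=> kl ak.
pose Q v := \sum_(j < l.+1 | (k < j)%N) acoef l a j * v ^+ (2 * (j - k.+1)).
exists Q, (\sum_(j < l.+1 | (k < j)%N) `|acoef l a j| * V ^+ (2 * (j - k.+1))).
split.
- by apply: sumr_ge0 => j _; rewrite mulr_ge0 // mulnC exprM sqr_ge0.
- move=> v /andP[v0 vV]; apply: (le_trans (ler_norm_sum _ _ _)).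
  apply: ler_sum => j _; rewrite normrM ler_wpM2l // ger0_norm ?exprn_ge0 //.
  by apply: lerXn2r; rewrite ?nnegrE //; exact: le_trans vV.
move=> v.
have -> : v ^+ (2 * l) + \sum_(j < l) a j * v ^+ (2 * j) =
          \sum_(j < l.+1) acoef l a j * v ^+ (2 * j).
  rewrite big_ord_recr /= /acoef eqxx mul1r addrC; congr (_ + _).
  by apply: eq_bigr => j _; rewrite ltn_eqF.
have kl1 : (k < l.+1)%N by rewrite ltnS.
rewrite (bigD1 (Ordinal kl1)) //= mulrDr [acoef l a k * _]mulrC; congr (_ + _).
rewrite /Q !mulr_sumr big_mkcond [RHS]big_mkcond /=; apply: eq_bigr => j _.
rewrite -val_eqE /=; case: (ltngtP k j) => [kj|jk|_] //=.
  have -> : (2 * j = 2 * k + (2 + 2 * (j - k.+1)))%N.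
    by rewrite -{1}(subnKC kj) mulnDr mulnS addnA [(2 * k + 2)%N]addnC.
  by rewrite !exprD; ring.
by rewrite /acoef ltn_eqF ?(leq_trans jk) // ak // mul0r.
Qed.

(* The reciprocal radius, as a function of the angle run towards infinity, solves [f' = - f^(2k+1) q] with [q] close to [b] when [f] is small. *)
Lemma traj_normal_form (R : realType) (l : nat) (a : nat -> R) (up : bool)
    (phi0 : R) (F : R -> R) (k : nat) :
  (k <= l)%N -> (forall j, (j < k)%N -> a j = 0) ->
  traj_near_infinity l a up phi0 F ->
  let s := orient R up in let t0 := s * phi0 in let f t := (F (s * t))^-1 in
  exists (q : R -> R) (V M : R), 0 <= M /\
    [/\ (forall t, t0 <= t -> is_derive t 1 f (- (f t ^+ (2 * k).+1 * q t))),
        (forall t, t0 <= t -> 0 < f t),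
        (forall t, t0 <= t -> f t <= V),
        (forall t, t0 <= t -> `|q t - (- s * acoef l a k)| <= M * f t ^+ 2) &
        (forall d : R, 0 < d ->
           exists2 t1, t0 <= t1 & forall t, t1 <= t -> f t < d)].
Proof.
move=> kl ak [hF [[m [m0 Fm]] Finf]] s t0 f.
have rng t : t0 <= t -> angle_range up phi0 (s * t).
  by move=> tt; apply/angle_rangeE; rewrite orientK.
have F0 t : t0 <= t -> 0 < F (s * t) by move=> /rng/Fm; exact: lt_le_trans.
have f0 t : t0 <= t -> 0 < f t by move=> tt; rewrite invr_gt0 F0.
have fV t : t0 <= t -> f t <= m^-1.
  by move=> tt; rewrite lef_pV2 ?posrE ?F0 //; apply: Fm; exact: rng.
have [Q [M [M0 QM QE]]] := rhs_expansion _ l a k m^-1 kl ak.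
(* Since [F (s * t)] has derivative [s * rho_rhs], its reciprocal satisfies [f' = s * f^(2k+1) *
   (acoef l a k + f^2 * Q f)], whence the factor [- s]. *)
exists (fun t => - s * (acoef l a k + f t ^+ 2 * Q (f t))), m^-1, M.
split => //; split => //.
- move=> t tt; have Fn0 : F (s * t) != 0 by rewrite gt_eqF // F0.
  have H1 := is_derive_affine _ s 0 t.
  have st : 0 + s * t = s * t by rewrite add0r.
  have H2 : is_derive (0 + s * t) 1 F (rho_rhs l a (F (s * t))).
    by rewrite st; exact: hF (rng t tt).
  have H3 := @is_derive1_comp R F (fun t => 0 + s * t) t _ _ H2 H1.
  have Fn0' : (F \o (fun t => 0 + s * t)) t != 0 by rewrite /= st.
  have H4 := is_deriveV Fn0' H3.
  have -> : f = (fun y => ((F \o (fun t => 0 + s * t)) y)^-1).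
    by apply/funext => y; rewrite /f /= add0r.
  apply: is_derive_eq; rewrite /GRing.scale /= !add0r /rho_rhs.
  under eq_bigr => j _ do rewrite -exprVn.
  rewrite -!exprVn -/(f t) QE [f t ^+ (2 * k).+1]exprS.
  have -> : F (s * t) = (f t)^-1 by rewrite invrK.
  by set P := f t ^+ (2 * k); field; rewrite gt_eqF // f0.
- move=> t tt.
  have -> : - s * (acoef l a k + f t ^+ 2 * Q (f t)) - - s * acoef l a k =
    - (s * (f t ^+ 2 * Q (f t))) by ring.
  rewrite normrN normrM.
  have -> : `|s| = 1 by rewrite /s /orient; case: (up); rewrite ?normrN normr1.
  rewrite mul1r normrM ger0_norm ?sqr_ge0 // mulrC ler_wpM2r ?sqr_ge0 //.
  by apply: QM; rewrite fV // ltW // f0.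
move=> d d0.
have [N FN] : exists N, forall t, N < t -> d^-1 < F (s * t).
  move: Finf; rewrite /s /orient; case: (up) => Finf.
    have [N [_ hN]] := (cvgryPgt _).1 Finf d^-1.
    by exists N => t; rewrite mul1r; exact: hN.
  have [N [_ hN]] := (cvgryPgt _).1 Finf d^-1.
  by exists (- N) => t Nt; rewrite mulN1r; apply: hN; lra.
exists (Num.max t0 (N + 1)); first by rewrite le_max lexx.
move=> t; rewrite ge_max => /andP[tt Nt].
rewrite /f -[d]invrK ltf_pV2 ?posrE ?invr_gt0 ?F0 //; apply: FN; lra.
Qed.

(** * Comparison with the model spirals, and box dimensions *)

Lemma powR_root (R : realType) (n : nat) (x : R) : (0 < n)%N -> 0 <= x ->
  (x ^+ n) `^ (n%:R)^-1 = x.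
Proof.
move=> n0 x0; rewrite -powR_mulrn // -powRrM mulfV ?powRr1 //.
by rewrite pnatr_eq0 -lt0n.
Qed.

Lemma exponential_spiral_comparable (R : realType) (up : bool) (phi0 a0 C : R)
    (F : R -> R) :
  (forall phi, angle_range up phi0 phi -> 0 < F phi) ->
  (forall phi, angle_range up phi0 phi -> `|ln (F phi) + a0 * phi| <= C) ->
  spiral_comparable up phi0 F (fun phi => expR (- a0 * phi)).
Proof.
move=> F0 lnF; exists (expR (- C)), (expR C); split; first exact: expR_gt0.
split; first exact: expR_gt0.
exists phi0 => phi hphi _; rewrite -!expRD.
have -> : F phi = expR (ln (F phi)) by rewrite lnK // posrE F0.
rewrite !ler_expR; have := lnF phi hphi; rewrite ler_norml => /andP[h1 h2].
by apply/andP; split; lra.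
Qed.

Lemma power_spiral_comparable (R : realType) (up : bool) (phi0 c C : R)
    (F : R -> R) (n : nat) :
  let s := orient R up in
  (0 < n)%N -> 0 < c -> 0 < C ->
  (forall phi, angle_range up phi0 phi -> 0 < F phi) ->
  (forall phi, angle_range up phi0 phi ->
     c * (s * phi - s * phi0 + 1) <= F phi ^+ n <= C * (s * phi - s * phi0 + 1)) ->
  spiral_comparable up phi0 F (fun phi => `|phi| `^ (1 / n%:R)).
Proof.
move=> s n0 c0 C0 F0 Fn.
exists ((c / 2) `^ n%:R^-1), ((2 * C) `^ n%:R^-1).
split; first by rewrite powR_gt0 // divr_gt0.
split; first by rewrite powR_gt0 // mulr_gt0.
(* From here on [s * phi - s * phi0 + 1] lies between [s * phi / 2] and [2 * (s * phi)], which
   explains the constants [c / 2] and [2 * C]. *)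
exists (s * (2 * `|s * phi0| + 2)) => phi hphi far.
have {far} far : 2 * `|s * phi0| + 2 <= s * phi.
  rewrite -(orientK _ up (2 * _ + 2)) -/s; apply/(angle_rangeE _ up).
  by rewrite /angle_range; case: (up) far.
have := ler_norm (s * phi0); have := ler_norm (- (s * phi0)); rewrite normrN.
move=> n1 n2.
have phiE : `|phi| = s * phi.
  have <- : `|s * phi| = `|phi|.
    by rewrite normrM /s /orient; case: (up); rewrite ?normrN normr1 mul1r.
  by rewrite ger0_norm //; lra.
have /andP[lo hi] := Fn phi hphi; have Fp := F0 phi hphi.
have ninv : 0 <= n%:R^-1 :> R by rewrite invr_ge0.
rewrite phiE div1r -!powRM; try lra.
rewrite -[F phi](powR_root _ n) //; last exact: ltW.
have p1 : 0 <= c / 2 * (s * phi) by apply: mulr_ge0; lra.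
have p2 : 0 <= 2 * C * (s * phi) by apply: mulr_ge0; lra.
have p3 : 0 <= F phi ^+ n by rewrite exprn_ge0 // ltW.
by apply/andP; split; apply: ge0_ler_powR; rewrite ?nnegrE //; nra.
Qed.

Lemma box_dim_exponential (R : realType) (tau t0 V M b : R) (f q : R -> R) :
  tau ^+ 2 = 1 -> b != 0 -> 0 <= M ->
  (forall t, t0 <= t -> is_derive t 1 f (- (f t ^+ (2 * 0).+1 * q t))) ->
  (forall t, t0 <= t -> 0 < f t) -> (forall t, t0 <= t -> f t <= V) ->
  (forall t, t0 <= t -> `|q t - b| <= M * f t ^+ 2) ->
  (forall d : R, 0 < d -> exists2 t1, t0 <= t1 & forall t, t1 <= t -> f t < d) ->
  has_box_dim (polar_curve tau t0 f) 1.
Proof.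
move=> tau2 bn0 M0 hf f0 fV qb to0.
have b0 := rate_limit_gt0 _ _ _ _ _ _ _ hf f0 M0 qb to0 bn0.
have [C C0 decay] := exponential_decay _ _ _ _ _ _ _ _ hf f0 fV M0 qb to0 bn0 erefl.
have K0 : 0 <= `|b| + M * V ^+ 2 by rewrite addr_ge0 // mulr_ge0 // sqr_ge0.
have df t : t0 <= t ->
    `|- (f t ^+ (2 * 0).+1 * q t)| <= (`|b| + M * V ^+ 2) * f t.
  move=> tt; rewrite muln0 expr1 normrN normrM gtr0_norm ?f0 // mulrC.
  rewrite ler_pM2r ?f0 //; exact: (rate_bounded _ _ _ _ _ _ _ f0 fV M0 qb).
have [|c [C' [c0 C'0 bounds]]] := area_bounds_exponential _ _ _ _ (b / 2) _ _ _
  tau2 C0 _ K0 f0 hf decay df.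
  by rewrite divr_gt0.
apply: (has_box_dim_area_bounds _ _ _ _ _ _ _ _ c0 C'0 ltr01).
- by exists (f t0 * cos t0, tau * (f t0 * sin t0)), t0 => /=.
- exact: polar_curve_bounded tau2 f0 fV.
move=> e he; have -> : 2 - 1 = 1 :> R by ring.
by rewrite powRr1; [exact: bounds|case/andP: he => /ltW].
Qed.

(** With [alpha = 1/(2k)], taking roots in [algebraic_decay] gives [f] of order [u^(-alpha)] for
    [u = t - t0 + 1], and [2 / (1 + alpha)] is the claimed dimension. *)
Lemma box_dim_power (R : realType) (tau t0 V M b : R) (f q : R -> R) (k : nat) :
  tau ^+ 2 = 1 -> b != 0 -> 0 <= M -> (0 < k)%N ->
  (forall t, t0 <= t -> is_derive t 1 f (- (f t ^+ (2 * k).+1 * q t))) ->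
  (forall t, t0 <= t -> 0 < f t) -> (forall t, t0 <= t -> f t <= V) ->
  (forall t, t0 <= t -> `|q t - b| <= M * f t ^+ 2) ->
  (forall d : R, 0 < d -> exists2 t1, t0 <= t1 & forall t, t1 <= t -> f t < d) ->
  has_box_dim (polar_curve tau t0 f) ((4 * k)%:R / (2 * k + 1)%:R).
Proof.
move=> tau2 bn0 M0 k0 hf f0 fV qb to0.
have [c [C [c0 C0 decay]]] :=
  algebraic_decay _ _ _ _ _ _ _ _ hf f0 fV M0 qb to0 bn0 k0.
have k20 : (0 < 2 * k)%N by rewrite muln_gt0.
have kR : 1 <= k%:R :> R by rewrite ler1n.
pose alpha : R := (2 * k)%:R^-1.
have alE : alpha = (2 * k%:R)^-1 by rewrite /alpha natrM.
have al0 : 0 < alpha by rewrite invr_gt0 ltr0n.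
have al1 : alpha < 1 by rewrite alE invf_lt1; lra.
have root t : t0 <= t -> f t = ((f t)^-1 ^+ (2 * k)) `^ (- alpha).
  move=> tt; rewrite powRN powR_root ?invrK // invr_ge0 ltW //; exact: f0.
have u0 t : t0 <= t -> 0 < t - t0 + 1 by lra.
(* The negative exponent exchanges the bounds: [C] now serves below and [c] above. *)
have flo t : t0 <= t -> C `^ (- alpha) * (t - t0 + 1) `^ (- alpha) <= f t.
  move=> tt; have /andP[_ hi] := decay t tt; have ut := u0 t tt.
  rewrite -powRM ?(ltW C0) ?(ltW ut) // (root t tt).
  by apply: powRN_anti => //; [rewrite exprn_gt0 // invr_gt0 f0|exact: ltW].
have fhi t : t0 <= t -> f t <= c `^ (- alpha) * (t - t0 + 1) `^ (- alpha).
  move=> tt; have /andP[lo _] := decay t tt; have ut := u0 t tt.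
  rewrite -powRM ?(ltW c0) ?(ltW ut) // (root t tt).
  by apply: powRN_anti => //; [rewrite mulr_gt0|exact: ltW].
pose K := (`|b| + M * V ^+ 2) * (c `^ (- alpha)) ^+ (2 * k).+1.
have Kq0 : 0 <= `|b| + M * V ^+ 2 by rewrite addr_ge0 // mulr_ge0 // sqr_ge0.
have K0 : 0 <= K by rewrite mulr_ge0 // exprn_ge0 // powR_ge0.
have df t : t0 <= t ->
    `|- (f t ^+ (2 * k).+1 * q t)| <= K * (t - t0 + 1) `^ (- (1 + alpha)).
  move=> tt; rewrite normrN normrM normrX (gtr0_norm (f0 t tt)) mulrC /K -mulrA.
  apply: ler_pM => //; first by rewrite exprn_ge0 // ltW // f0.
    exact: (rate_bounded _ _ _ _ _ _ _ f0 fV M0 qb).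
  (* Because [(2k + 1) * alpha = 1 + alpha]. *)
  have -> : (t - t0 + 1) `^ (- (1 + alpha)) = ((t - t0 + 1) `^ (- alpha)) ^+ (2 * k).+1.
    rewrite -powR_mulrn ?powR_ge0 // -powRrM -natr1 natrM alE.
    by congr (_ `^ _); field; lra.
  rewrite -exprMn; apply: lerXn2r; rewrite ?nnegrE ?mulr_ge0 ?powR_ge0 ?fhi //.
  exact: ltW (f0 t tt).
have [c' [C' [e0 [c'0 C'0 e00 bounds]]]] := area_bounds_algebraic _ _ _ alpha
  _ _ _ _ _ tau2 (introT andP (conj al0 al1)) (powR_gt0 (- alpha) C0)
  (powR_gt0 (- alpha) c0) K0 hf flo fhi df to0.
apply: (has_box_dim_area_bounds _ _ _ _ _ _ _ _ c'0 C'0 e00).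
- by exists (f t0 * cos t0, tau * (f t0 * sin t0)), t0 => /=.
- exact: polar_curve_bounded tau2 f0 fV.
have -> : (4 * k)%:R / (2 * k + 1)%:R = 2 / (1 + alpha) :> R.
  by rewrite alE !natrM natrD natrM; field; lra.
exact: bounds.
Qed.

Theorem theorem4p1 (R : realType) (l : nat) (a : nat -> R) (up : bool)
  (phi0 : R) (F : R -> R) :
  (1 <= l)%N ->
  traj_near_infinity l a up phi0 F ->
  (a 0%N != 0 ->
     spiral_comparable up phi0 F (fun phi => expR (- a 0%N * phi)) /\
     has_box_dim_unb (spiral up phi0 F) 1) /\
  (forall k : nat, (1 <= k <= l)%N ->
     (forall j : nat, (j < k)%N -> a j = 0) -> acoef l a k != 0 ->
     spiral_comparable up phi0 F (fun phi => `|phi| `^ (1 / (2 * k)%:R)) /\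
     has_box_dim_unb (spiral up phi0 F) ((4 * k)%:R / (2 * k + 1)%:R)).
Proof.
move=> l1 traj; have [_ [[m [m0 Fm]] _]] := traj.
have F0 phi : angle_range up phi0 phi -> 0 < F phi by move=> /Fm; exact: lt_le_trans.
have away := closure_spiral _ _ _ _ _ m0 Fm.
have s2 := orient_sqr R up.
have sn0 : - orient R up != 0 by rewrite oppr_eq0 -sqrf_eq0 s2 oner_eq0.
split => [a0|k /andP[k1 kl] ak Ak].
  have [//|q [V [M [M0 [hf f0 fV qb to0]]]]] :=
    traj_normal_form _ l a up phi0 F 0 (leq0n l) _ traj.
  have A0 : acoef l a 0 = a 0%N by rewrite /acoef ltn_eqF.
  have bn0 : - orient R up * acoef l a 0 != 0 by rewrite mulf_neq0 // A0.
  split; last first.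
    split => //; rewrite inversion_spiral //.
    exact: box_dim_exponential s2 bn0 M0 hf f0 fV qb to0.
  have [C asym] := exponential_asymptotics _ _ _ _ _ _ _ _ hf f0 fV M0 qb to0 bn0 erefl.
  apply: (exponential_spiral_comparable _ _ _ _ C) => // phi hphi.
  (* At [t = s * phi] the two signs [s] cancel, so [ln f + b t] is the negative of
     [ln (F phi) + a 0 * phi]. *)
  have := asym _ (proj1 (angle_rangeE _ _ _ _) hphi).
  rewrite orientK lnV ?posrE ?F0 // A0 -normrN opprD opprK.
  by rewrite mulNr mulNr opprK mulrCA [_ * phi]mulrC -mulrA orientK [phi * _]mulrC.
have [q [V [M [M0 [hf f0 fV qb to0]]]]] :=
  traj_normal_form _ l a up phi0 F k kl ak traj.
have bn0 : - orient R up * acoef l a k != 0 by rewrite mulf_neq0.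
split; last first.
  split => //; rewrite inversion_spiral //.
  exact: box_dim_power s2 bn0 M0 k1 hf f0 fV qb to0.
have [c [C [c0 C0 decay]]] :=
  algebraic_decay _ _ _ _ _ _ _ _ hf f0 fV M0 qb to0 bn0 k1.
apply: (power_spiral_comparable _ _ _ c C) => //; first by rewrite muln_gt0.
move=> phi hphi; have := decay _ (proj1 (angle_rangeE _ _ _ _) hphi).
by rewrite orientK invrK.
Qed.
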